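(* For every integer $k\ge 1$ there is a constant $c_k$ such that for every graph $G$ with $m$ edges and no isolated vertices, \[ r_{k+1}(K_3;G)\le c_k\, m^{\frac{k+1}{2}}. \]
   Context: For a graph $G$ and integer $k\ge1$, the multicolor Ramsey number $r_{k+1}(K_3;G)$ is the least positive integer $N$ such that every coloring of the edges of the complete graph $K_N$ with colors $1,\dots,k+1$ contains either a triangle $K_3$ all of whose edges have the same color $i$ for some $i\in\{1,\dots,k\}$, or a copy of $G$ all of whose edges have color $k+1$. *)

(* Defs.v *)
From mathcomp Require Import all_boot.

Set Implicit Arguments.
Unset Strict Implicit.
Unset Printing Implicit Defensive.

Record sgraph := SGraph {
  vertex :> finType;
  adj : rel vertex;
  adj_sym : symmetric adj;
  adj_irr : irreflexive adj }.

Definition edges (G : sgraph) : {set {set G}} :=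
  [set [set p.1; p.2] | p : G * G & adj p.1 p.2].

Definition no_isolated (G : sgraph) : Prop :=
  forall x : G, exists y : G, adj x y.

Lemma neq_sym (T : eqType) : symmetric (fun x y : T => x != y).
Proof. by move=> x y; rewrite eq_sym. Qed.

Lemma neq_irr (T : eqType) : irreflexive (fun x y : T => x != y).
Proof. by move=> x; rewrite eqxx. Qed.

Definition complete_graph (n : nat) : sgraph :=
  @SGraph 'I_n (fun x y => x != y) (@neq_sym _) (@neq_irr _).

(* An edge [x y] of K_N is the set [set x; y]; the values of a coloring on     *)
(* sets that do not have exactly two elements are never used.                 *)
Definition coloring (N q : nat) := {ffun {set 'I_N} -> 'I_q}.

Definition mono_copy (N q : nat) (c : coloring N q) (H : sgraph) (i : 'I_q) :
    bool :=
  [exists f : {ffun H -> 'I_N}, injectiveb f &&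
    [forall u, forall v, adj u v ==> (c [set f u; f v] == i)]].

(* The colors 1, ..., k+1 are the elements 0, ..., k of 'I_k.+1; in           *)
(* particular the color k+1 is ord_max.                                       *)
Definition ramsey_prop (k : nat) (G : sgraph) (N : nat) : bool :=
  [forall c : coloring N k.+1,
    [exists i : 'I_k.+1, (i < k) && mono_copy c (complete_graph 3) i]
    || mono_copy c G ord_max].

Definition bounded_by (k n : nat) (D : {set 'I_k.+1}) (B : nat) : Prop :=
  forall N (c : coloring N k.+1) (A : {set 'I_N}),
    {in A &, forall x y, x != y -> c [set x; y] \in ord_max |: D} ->
    B <= #|A| ->
    (exists i : 'I_k.+1, (i < k) && mono_copy c (complete_graph 3) i)
    \/ exists S : {set 'I_N}, [/\ S \subset A, #|S| = n
         & {in S &, forall x y, x != y -> c [set x; y] = ord_max}].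

Lemma triangleP k N (c : coloring N k.+1) i x y z :
  x != y -> x != z -> y != z -> c [set x; y] = i -> c [set x; z] = i ->
  c [set y; z] = i -> mono_copy c (complete_graph 3) i.
Proof.
move=> nxy nxz nyz cxy cxz cyz; apply/existsP.
exists [ffun u : 'I_3 => nth x [:: x; y; z] u]; apply/andP; split.
  apply/injectiveP => u v; rewrite !ffunE => /eqP.
  rewrite nth_uniq //= ?inE ?negb_or ?nxy ?nxz ?nyz //.
  by move/eqP/val_inj.
apply/forallP => u; apply/forallP => v; apply/implyP; rewrite !ffunE /=.
case: u => [[|[|[|//]]] ?]; case: v => [[|[|[|//]]] ?] //= _; apply/eqP => //;
by rewrite setUC.
Qed.

Lemma ramsey_bound k j n (D : {set 'I_k.+1}) :
  #|D| <= j -> exists B, bounded_by n D B.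
Proof.
elim: j n D => [|j IHj] n D.
  rewrite leqn0 cards_eq0 => /eqP->; exists n => N c A Ac leA; right.
  have [S SA Sn]: exists2 S : {set 'I_N}, S \subset A & #|S| = n.
    exists [set x in take n (enum A)].
      by apply/subsetP => x; rewrite inE => /mem_take; rewrite mem_enum.
    rewrite cardsE (card_uniqP (take_uniq _ (enum_uniq _))) size_takel //.
    by rewrite -cardE.
  exists S; split=> // x y xS yS nxy; apply/set1P.
  by have := Ac x y (subsetP SA x xS) (subsetP SA y yS) nxy; rewrite setU0.
elim: n D => [|n IHn] D leD.
  by exists 0 => N c A _ _; right; exists set0; split;
    rewrite ?sub0set ?cards0 // => x y; rewrite inE.
have [B1 HB1] := IHn D leD.
have [f Hf]: exists f : 'I_k.+1 -> nat,
    forall i, i \in D -> bounded_by n.+1 (D :\ i) (f i).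
  have /fin_all_exists : forall i, exists B,
      i \in D -> bounded_by n.+1 (D :\ i) B.
    move=> i; have [iD|iD] := boolP (i \in D); last by exists 0.
    have [|B HB] := IHj n.+1 (D :\ i); last by exists B.
    by move: leD; rewrite (cardsD1 i) iD.
  by case=> f Hf; exists f.
pose M := (B1 + \sum_i f i).+1.
exists (k.+1 * M).+2 => N c A Ac leA.
have [v vA] : exists v, v \in A by apply/card_gt0P; apply: leq_trans leA.
pose A_ i := [set x in A | (x != v) && (c [set v; x] == i)].
have [i leMi] : exists i, M <= #|A_ i|.
  apply/existsP; apply: contraLR leA; rewrite negb_exists -ltnNge => /forallP h.
  rewrite (cardsD1 v) vA add1n 2!ltnS.
  have -> : #|A :\ v| = \sum_i #|A_ i|.
    rewrite -sum1_card (partition_big (fun x => c [set v; x]) predT) //=.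
    apply: eq_bigr => i _; rewrite -sum1_card; apply: eq_bigl => x.
    by rewrite !inE andbA (andbC (x \in A)).
  rewrite -[X in X * _](card_ord k.+1) -sum_nat_const; apply: leq_sum => i _.
  by apply: ltnW; rewrite ltnNge.
have sAA : A_ i \subset A by apply/subsetP => x; rewrite inE => /andP[].
have A_v x : x \in A_ i -> [/\ x \in A, x != v & c [set v; x] = i].
  by rewrite inE => /and3P[? ? /eqP].
have Aic : {in A_ i &, forall x y, x != y -> c [set x; y] \in ord_max |: D}.
  by move=> x y /(subsetP sAA) xA /(subsetP sAA) yA; apply: Ac.
have [imax|inmax] := eqVneq i ord_max.
  have leB1 : B1 <= #|A_ i|.
    by apply: leq_trans leMi; rewrite /M -addnS leq_addr.
  case: (HB1 N c (A_ i) Aic leB1) => [|[S [SA Sn Sc]]]; first by left.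
  right; exists (v |: S); split.
  - by rewrite subUset sub1set vA (subset_trans SA).
  - rewrite cardsU1 Sn; case: (boolP (v \in S)) => // /(subsetP SA) /A_v[_].
    by rewrite eqxx.
  - move=> x y /setU1P[->|xS] /setU1P[->|yS]; rewrite ?eqxx // => nxy.
    + by case/(subsetP SA)/A_v: yS => _ _ ->.
    + by rewrite setUC; case/(subsetP SA)/A_v: xS => _ _ ->.
    + exact: Sc.
have ltik : i < k by rewrite ltn_neqAle -ltnS ltn_ord andbT; move: inmax.
have iD : i \in D.
  have [x /A_v[xA xv cx]] : exists x, x \in A_ i.
    by apply/card_gt0P; apply: leq_trans leMi.
  have := Ac v x vA xA; rewrite eq_sym cx => /(_ xv).
  by case/setU1P => // E; rewrite E eqxx in inmax.
have [/existsP[p /and4P[pA qA npq /eqP cpq]]|noi] := boolP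
    [exists p : 'I_N * 'I_N, [&& p.1 \in A_ i, p.2 \in A_ i, p.1 != p.2
      & c [set p.1; p.2] == i]].
  left; exists i; rewrite ltik /=.
  case/A_v: pA => _ pv cp; case/A_v: qA => _ qv cq.
  by apply: (@triangleP _ _ _ _ v p.1 p.2) => //; rewrite eq_sym.
case: (Hf i iD N c (A_ i)) => [x y xA yA nxy|||[S [SA Sn Sc]]].
- have := Aic x y xA yA nxy; rewrite !inE => /orP[->//|->]; rewrite andbT.
  apply/orP; right; apply: contra noi => ci.
  by apply/existsP; exists (x, y); rewrite /= xA yA nxy ci.
- apply: leq_trans leMi; rewrite /M -addSn (bigD1 i) //= addnCA.
  exact: leq_addr.
- by left.
- by right; exists S; split=> //; apply: subset_trans SA sAA.
Qed.

Lemma ramsey_exists (k : nat) (G : sgraph) : exists N, (0 < N) && ramsey_prop k G N.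
Proof.
have [B HB] := @ramsey_bound k _ #|G| setT (leqnn _).
exists B.+1; apply/forallP => c.
case: (HB _ c setT) => [x y _ _ _||/existsP->//|[S [_ Sn Sc]]].
- by rewrite !inE orbT.
- by rewrite cardsT card_ord.
apply/orP; right; apply/existsP.
exists [ffun u : G => enum_val (cast_ord (esym Sn) (enum_rank u))].
have finj : injective (fun u : G => enum_val (cast_ord (esym Sn) (enum_rank u))).
  by move=> u v /enum_val_inj/cast_ord_inj/enum_rank_inj.
apply/andP; split.
  by apply/injectiveP => u v; rewrite !ffunE => /finj.
apply/forallP => u; apply/forallP => v; apply/implyP => uv.
rewrite !ffunE; apply/eqP/Sc; try exact: enum_valP.
by rewrite (inj_eq finj); apply: contraTneq uv => ->; rewrite adj_irr.
Qed.

(* r_{k+1}(K_3; G) *)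
Definition ramsey (k : nat) (G : sgraph) : nat := ex_minn (ramsey_exists k G).

(* Main.v *)
(** Call color [k+1] blue.  Given a set [A] of vertices of the host, embed [G]
    in blue inside [A], repeatedly choosing a vertex of least degree among those
    not yet chosen to be placed last.  This succeeds unless some vertex of [A]
    has many non-blue neighbors in [A], hence many neighbors in one of the
    triangle-free colors, and that neighborhood misses this color altogether:
    one concludes by induction on the number of colors.  Removing a color
    costs a factor of the order of the degeneracy of [G], which is at most
    [sqrt (2m)].  The last one to be removed is cheaper: its neighborhoods are
    blue cliques, which only need as many vertices as the part of [G] to be
    embedded, and least degree times number of vertices is at most [2m] for
    every part of [G]. *)

Require Import Defs.
From mathcomp Require Import all_boot all_order all_algebra.
From mathcomp Require Import reals exp.

Set Implicit Arguments.
Unset Strict Implicit.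
Unset Printing Implicit Defensive.

Import Order.TTheory GRing.Theory Num.Theory.

Lemma leq_card_bigcup (I T : finType) (D : {set I}) (F : I -> {set T}) n :
  {in D, forall i, #|F i| <= n} -> #|\bigcup_(i in D) F i| <= #|D| * n.
Proof.
move=> leFn; rewrite -cover_imset; apply: leq_trans (leq_card_cover _).1 _.
apply: leq_trans (_ : #|F @: D| * n <= _); last first.
  by rewrite leq_mul2r leq_imset_card orbT.
by rewrite -sum_nat_const; apply: leq_sum => _ /imsetP[i iD ->]; apply: leFn.
Qed.

Lemma bigcup_pigeonhole (I T : finType) (D : {set I}) (F : I -> {set T})
    (B : {set T}) n :
  B \subset \bigcup_(i in D) F i -> #|D| * n < #|B| ->
  exists2 i, i \in D & n < #|F i|.
Proof.
move=> /subset_leq_card leBF ltB; apply/exists_inP; apply: contraLR ltB.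
rewrite negb_exists_in -leqNgt => /forall_inP noF.
by apply: leq_trans leBF (leq_card_bigcup _) => i /noF; rewrite -leqNgt.
Qed.

Lemma leq_fact_expnS d i j n q m :
  0 < d -> q <= d -> m <= n ->
  q * (j * (j`! * d ^ i * n)) + m <= j.+1`! * d ^ i.+1 * n.
Proof.
move=> d_gt0 leqd lemn; rewrite factS mulSnr -[leqRHS]mulnA mulnDl leq_add //.
  by rewrite expnS mulnCA !mulnA (mulnAC j) !leq_mul.
apply: leq_trans lemn _; rewrite mulnA leq_pmull //.
by rewrite muln_gt0 fact_gt0 expn_gt0 d_gt0.
Qed.

Section Graph.
Variable G : sgraph.
Implicit Types (u v : G) (S : {set G}).

Lemma adj_neq u v : adj u v -> u != v.
Proof. by apply: contraTneq => ->; rewrite adj_irr. Qed.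

Definition nbhd S v := [set u in S | adj v u].

Definition non_nbhd S v := [set u in S | (u != v) && ~~ adj v u].

Lemma nbhd_sub S v : nbhd S v \subset S.
Proof. by apply/subsetP => u; rewrite inE => /andP[]. Qed.

Lemma nbhdS S S' v : S \subset S' -> nbhd S v \subset nbhd S' v.
Proof.
by move/subsetP => sSS'; apply/subsetP => u; rewrite !inE => /andP[/sSS' ->].
Qed.

Lemma edge_orientations u v : adj u v ->
  [set p : G * G | adj p.1 p.2 & [set p.1; p.2] == [set u; v]]
    = [set (u, v); (v, u)].
Proof.
move=> uv; apply/setP => -[x y]; rewrite !inE !xpair_eqE /=.
apply/idP/idP => [/andP[xy /eqP eq_uv]|]; last first.
  by case/orP=> /andP[/eqP-> /eqP->]; [|rewrite adj_sym setUC]; rewrite uv /=.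
have /set2P ex : x \in [set u; v] by rewrite -eq_uv set21.
have /set2P ey : y \in [set u; v] by rewrite -eq_uv set22.
by case: ex ey xy => -> [] ->; rewrite ?adj_irr // !eqxx ?orbT.
Qed.

Lemma sum_degree : \sum_v #|nbhd setT v| = 2 * #|edges G|.
Proof.
pose arcs := [set p : G * G | adj p.1 p.2].
have -> : \sum_v #|nbhd setT v| = \sum_(p in arcs) 1.
  under eq_bigr do rewrite -sum1_card.
  by rewrite pair_big_dep; apply: eq_bigl => -[u v]; rewrite !inE.
rewrite (partition_big_imset (fun p : G * G => [set p.1; p.2])) /=.
have -> : edges G = [set [set p.1; p.2] | p in arcs].
  apply/setP => e; apply/imsetP/imsetP => -[p p_arc ->];
  by exists p; rewrite // ?inE // in p_arc *.
rewrite mulnC -sum_nat_const; apply: eq_bigr => _ /imsetP[[u v] uv ->].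
rewrite inE /= in uv.
have <- : #|[set (u, v); (v, u)]| = 2.
  by rewrite cards2 xpair_eqE negb_and (adj_neq uv).
by rewrite -edge_orientations // -sum1_card; apply: eq_bigl => p; rewrite !inE.
Qed.

Lemma card_le_edges : no_isolated G -> #|G| <= 2 * #|edges G|.
Proof.
move=> iso; rewrite -sum_degree -sum1_card; apply: leq_sum => v _.
by have [u vu] := iso v; apply/card_gt0P; exists u; rewrite !inE.
Qed.

Definition min_degree S := \big[Order.min/#|S|]_(v in S) #|nbhd S v|.

Lemma min_degree_le_card S : min_degree S <= #|S|.
Proof. by rewrite -leEnat bigmin_le_id. Qed.

Lemma min_degree_le S v : v \in S -> min_degree S <= #|nbhd S v|.
Proof. by move=> vS; rewrite -leEnat bigmin_le_cond. Qed.

Lemma min_degree_attained S : S != set0 ->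
  exists2 v, v \in S & #|nbhd S v| = min_degree S.
Proof.
case/set0Pn => u uS; rewrite /min_degree.
have deg_le v : v \in S -> (#|nbhd S v| <= #|S|)%O.
  by rewrite leEnat subset_leq_card ?nbhd_sub.
by have [v vS ->] := eq_bigmin u (mem S) _ uS deg_le; exists v.
Qed.

Lemma min_degree_card_le_edges S : min_degree S * #|S| <= 2 * #|edges G|.
Proof.
rewrite mulnC -sum_nat_const -sum_degree [leqRHS](bigID (mem S)) /=.
apply: leq_trans (leq_addr _ _); apply: leq_sum => v vS.
apply: leq_trans (min_degree_le vS) _.
exact/subset_leq_card/nbhdS/subsetT.
Qed.

Definition degeneracy := \max_(S : {set G}) min_degree S.

Lemma degeneracy_sqr_le_edges : degeneracy ^ 2 <= 2 * #|edges G|.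
Proof.
rewrite /degeneracy; elim/big_ind: _ => // [m n|S _]; first by case: (leqP m n).
apply: leq_trans (min_degree_card_le_edges S).
by rewrite leq_mul2l min_degree_le_card orbT.
Qed.

Lemma degeneracy_gt0 : 0 < #|G| -> no_isolated G -> 0 < degeneracy.
Proof.
rewrite -cardsT card_gt0 => /min_degree_attained[v _ degv] iso.
apply: leq_trans (leq_bigmax setT); rewrite -degv.
by have [u vu] := iso v; apply/card_gt0P; exists u; rewrite !inE.
Qed.

End Graph.

Section Embedding.
Variables G H : sgraph.
Implicit Types (S : {set G}) (A B X : {set H}).

Definition embeds A S := exists f : G -> H,
  [/\ {in S &, injective f}, {in S, forall u, f u \in A}
    & {in S &, forall u v, adj u v -> adj (f u) (f v)}].

Lemma embedsS A B S : A \subset B -> embeds A S -> embeds B S.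
Proof.
move=> /subsetP sAB [f [f_inj fA f_adj]].
by exists f; split=> // u uS; apply/sAB/fA.
Qed.

Lemma embeds0 A : 0 < #|A| -> embeds A set0.
Proof. by case/card_gt0P => x _; exists (fun=> x); split=> u; rewrite inE. Qed.

Lemma common_neighbor A B X n :
  X \subset B -> {in X, forall x, #|non_nbhd A x| <= n} ->
  #|B| + #|X| * n < #|A| ->
  exists y, [/\ y \in A, y \notin B & {in X, forall x, adj x y}].
Proof.
move=> /subsetP sXB /leq_card_bigcup leX ltA.
have : ~~ (A \subset B :|: \bigcup_(x in X) non_nbhd A x).
  apply: contraTN ltA => /subset_leq_card leA; rewrite -leqNgt.
  apply: leq_trans leA _; apply: leq_trans (leq_card_setU _ _).1 _.
  by rewrite leq_add2l.
case/subsetPn => y yA; rewrite inE negb_or => /andP[yB yX].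
exists y; split=> // x xX; apply: contraNT yX => nxy; apply/bigcupP.
exists x => //; rewrite inE yA nxy andbT; apply: contraNneq yB => ->.
exact: sXB.
Qed.

Lemma embeds_add_vertex A S v n :
  v \in S -> {in A, forall x, #|non_nbhd A x| <= n} ->
  #|nbhd S v| * n + #|S| <= #|A| -> embeds A (S :\ v) -> embeds A S.
Proof.
move=> vS small leA [f [f_inj fA f_adj]].
have nbhdP u : u \in nbhd S v -> u \in S :\ v.
  by rewrite !inE => /andP[-> /adj_neq]; rewrite eq_sym => ->.
have [|||y [yA yf y_adj]] :=
  @common_neighbor A (f @: (S :\ v)) (f @: nbhd S v) n.
- by apply/imsetS/subsetP.
- by move=> _ /imsetP[u /nbhdP uS ->]; apply/small/fA.
- apply: leq_trans leA; rewrite (cardsD1 v S) vS addnC -addnS.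
  by rewrite leq_add ?ltnS ?leq_mul2r ?leq_imset_card ?orbT.
have y_new u : u \in S -> u != v -> y != f u.
  by move=> uS uv; apply: contraNneq yf => ->; rewrite imset_f // !inE uv.
have y_nbr u : u \in S -> adj v u -> adj (f u) y.
  by move=> uS vu; apply/y_adj/imset_f; rewrite inE uS.
exists (fun u => if u == v then y else f u); split=> [u w uS wS|u uS|u w uS wS].
- case: eqVneq => [->|uv]; case: eqVneq => [->|wv] // /eqP.
  + by rewrite (negPf (y_new _ _ _)).
  + by rewrite eq_sym (negPf (y_new _ _ _)).
  + by move/eqP; apply: f_inj; rewrite !inE ?uv ?wv.
- by case: eqVneq => // uv; apply: fA; rewrite !inE uv.
- case: eqVneq => [->|uv]; case: eqVneq => [->|wv]; first by rewrite adj_irr.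
  + by move=> vw; rewrite adj_sym y_nbr.
  + by rewrite adj_sym; apply: y_nbr.
  + by apply: f_adj; rewrite !inE ?uv ?wv.
Qed.

Lemma greedy_embedding A S (t : {set G} -> nat) :
  0 < #|A| ->
  (forall S', S' \subset S -> min_degree S' * t S' + #|S'| <= #|A|) ->
  (forall S' x, S' \subset S -> x \in A -> t S' < #|non_nbhd A x| ->
    embeds A S') ->
  embeds A S.
Proof.
move=> A_gt0; have [n] := ubnP #|S|; elim: n S => // n IHn S.
rewrite ltnS => leSn room dense.
have [->|/min_degree_attained[v vS degv]] := eqVneq S set0.
  exact: embeds0.
have [/exists_inP[x xA]|] := boolP [exists x in A, t S < #|non_nbhd A x|].
  exact: dense.
rewrite negb_exists_in => /forall_inP sparse.
apply: (embeds_add_vertex (n := t S) vS) => [x /sparse||].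
- by rewrite -leqNgt.
- by rewrite degv room.
have sub S' : S' \subset S :\ v -> S' \subset S.
  by move/subset_trans; apply; apply: subsetDl.
apply: IHn => [|S' /sub|S' x /sub]; [|exact: room|exact: dense].
by apply: leq_trans leSn; rewrite (cardsD1 v S) vS.
Qed.

Lemma clique_embeds A S :
  {in A &, forall x y, x != y -> adj x y} -> 0 < #|A| -> #|S| <= #|A| ->
  embeds A S.
Proof.
move=> clique A_gt0 leSA; apply: (greedy_embedding (t := fun=> 0)) => //.
  by move=> S' /subset_leq_card leS'; rewrite muln0 (leq_trans leS').
move=> S' x _ xA /card_gt0P[y]; rewrite inE => /and3P[yA yx].
by rewrite clique // eq_sym.
Qed.

End Embedding.

Section Coloring.
Variables (k N : nat) (c : coloring N k.+1).
Implicit Types (A : {set 'I_N}) (C : {set 'I_k.+1}) (i : 'I_k.+1).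

Definition color_adj i (x y : 'I_N) := (x != y) && (c [set x; y] == i).

Lemma color_adj_sym i : symmetric (color_adj i).
Proof. by move=> x y; rewrite /color_adj eq_sym setUC. Qed.

Lemma color_adj_irr i : irreflexive (color_adj i).
Proof. by move=> x; rewrite /color_adj eqxx. Qed.

Definition color_graph i := SGraph (@color_adj_sym i) (@color_adj_irr i).

Definition color_nbhd A x i : {set 'I_N} := @nbhd (color_graph i) A x.

Lemma in_color_nbhd A x i y :
  (y \in color_nbhd A x i) = [&& y \in A, x != y & c [set x; y] == i].
Proof. by rewrite inE. Qed.

Definition colored_by A C :=
  {in A &, forall x y, x != y -> c [set x; y] \in C}.

Definition triangle_free i := ~~ mono_copy c (complete_graph 3) i.

Lemma color_nbhd_colored_by A C x i :
  triangle_free i -> colored_by A C -> colored_by (color_nbhd A x i) (C :\ i).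
Proof.
move=> tri_free AC y z; rewrite !in_color_nbhd.
move=> /and3P[yA xy /eqP cy] /and3P[zA xz /eqP cz] yz.
rewrite !inE AC // andbT; apply: contraNneq tri_free => cyz.
exact: (triangleP xy xz yz).
Qed.

Lemma non_nbhd_color_cover A C x b : x \in A -> colored_by A C ->
  @non_nbhd (color_graph b) A x \subset \bigcup_(i in C :\ b) color_nbhd A x i.
Proof.
move=> xA AC; apply/subsetP => y; rewrite inE eq_sym => /and3P[yA xy].
rewrite /= /color_adj xy /= => cb; apply/bigcupP; exists (c [set x; y]).
  by rewrite !inE cb AC.
by rewrite in_color_nbhd yA xy /=.
Qed.

Lemma embeds_mono_copy (G : sgraph) A i :
  @embeds G (color_graph i) A setT -> mono_copy c G i.
Proof.
case=> f [f_inj _ f_adj]; apply/existsP; exists (finfun f); apply/andP; split.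
  by apply/injectiveP => u v; rewrite !ffunE; apply: f_inj.
apply/forallP => u; apply/forallP => v; apply/implyP => uv; rewrite !ffunE.
by case/andP: (f_adj u v (in_setT _) (in_setT _) uv).
Qed.

Variables (G : sgraph) (b : 'I_k.+1).

Definition embedding_threshold C (t : {set G} -> nat) := forall A S,
  colored_by A C -> 0 < #|A| -> t S <= #|A| -> @embeds G (color_graph b) A S.

Lemma embedding_threshold_clique C :
  C \subset [set b] -> embedding_threshold C (fun S => #|S|).
Proof.
move=> /subsetP sCb A S AC A_gt0 leSA; apply: clique_embeds => // x y xA yA xy.
by rewrite /= /color_adj xy -in_set1 sCb ?AC.
Qed.

Lemma embedding_threshold_step C t n :
  {in C :\ b, forall i, triangle_free i} ->
  {in C :\ b, forall i, embedding_threshold (C :\ i) t} ->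
  (forall S, min_degree S * (#|C :\ b| * t S) + #|S| <= n) ->
  embedding_threshold C (fun=> n).
Proof.
move=> tri_free smaller room A S AC A_gt0 leA.
apply: (greedy_embedding (t := fun S => #|C :\ b| * t S)) => //
  [S' _|S' x _ xA].
  exact: leq_trans (room S') leA.
case/(bigcup_pigeonhole (non_nbhd_color_cover b xA AC)) => i iC lt_nbhd.
apply: (@embedsS _ (color_graph b) (color_nbhd A x i)).
  exact: (@nbhd_sub (color_graph i)).
apply: (smaller i iC) (ltnW lt_nbhd); last exact: leq_ltn_trans lt_nbhd.
exact: color_nbhd_colored_by (tri_free i iC) AC.
Qed.

Lemma embedding_threshold_degeneracy n j C :
  0 < degeneracy G -> #|G| <= n -> 2 * #|edges G| <= n ->
  {in C :\ b, forall i, triangle_free i} -> #|C :\ b| = j.+1 ->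
  embedding_threshold C (fun=> j.+2`! * degeneracy G ^ j * n).
Proof.
move=> d_gt0 leGn lemn; have leSn (S : {set G}) : #|S| <= n.
  exact: leq_trans (max_card _) leGn.
have cardCD i C' : i \in C' :\ b -> #|(C' :\ i) :\ b| = #|C' :\ b|.-1.
  by move=> iC; rewrite (cardsD1 i (C' :\ b)) iC setDDl setUC -setDDl.
elim: j C => [|j IHj] C tri_free cardC.
- apply: (embedding_threshold_step (t := fun S => #|S|)) => // [i iC|S].
    apply: embedding_threshold_clique.
    by rewrite -setD_eq0 -cards_eq0 cardCD // cardC.
  rewrite cardC mul1n expn0 muln1 mul2n -addnn leq_add //.
  exact: leq_trans (min_degree_card_le_edges S) lemn.
- apply: embedding_threshold_step (tri_free) _ _ => [i iC|S].
    apply: IHj => [i'|]; last by rewrite cardCD // cardC.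
    by rewrite !inE => /and3P[i'b _ i'C]; apply: tri_free; rewrite !inE i'b.
  by rewrite cardC leq_fact_expnS //; apply: leq_bigmax.
Qed.

End Coloring.

Lemma ramsey_le k N (G : sgraph) : 0 < N ->
  (forall c : coloring N k.+1,
    (forall i : 'I_k.+1, i < k -> triangle_free c i) ->
    mono_copy c G ord_max) ->
  ramsey k G <= N.
Proof.
move=> N_gt0 blue_copy; rewrite /ramsey; case: ex_minnP => N' _; apply.
rewrite N_gt0; apply/forallP => c; apply/orP.
case: existsP => [|no_tri]; [by left|right].
apply: blue_copy => i i_lt; apply/negP => tri; apply: no_tri.
by exists i; rewrite i_lt.
Qed.

Lemma ramsey_le_degeneracy k n (G : sgraph) :
  0 < degeneracy G -> #|G| <= n -> 2 * #|edges G| <= n ->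
  ramsey k.+1 G <= k.+2`! * degeneracy G ^ k * n.
Proof.
move=> d_gt0 leGn lemn; set N := _ * n.
have N_gt0 : 0 < N.
  rewrite !muln_gt0 fact_gt0 expn_gt0 d_gt0 /=; apply: leq_trans lemn.
  by apply: leq_trans (degeneracy_sqr_le_edges G); rewrite expn_gt0 d_gt0.
apply: ramsey_le => // c tri_free.
have cardN : #|[set: 'I_N]| = N by rewrite cardsT card_ord.
apply: (@embeds_mono_copy _ _ _ _ [set: 'I_N]).
apply: (embedding_threshold_degeneracy (n := n) (j := k) (C := setT));
  rewrite ?cardN //.
- move=> i; rewrite !inE andbT => i_max; apply: tri_free.
  by rewrite ltn_neqAle -ltnS ltn_ord andbT.
- by rewrite setTD cardsC1 card_ord.
- by move=> x y _ _ _; rewrite inE.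
Qed.

Local Open Scope ring_scope.

Lemma natr_expM_le_powR (R : realType) (d j n : nat) : (d ^ 2 <= n)%N ->
  (d ^ j * n)%N%:R <= n%:R `^ (j.+2%:R / 2) :> R.
Proof.
move=> d2_le_n; rewrite mulrC powRrM powR12_sqrt // powR_mulrn ?sqrtr_ge0 //.
rewrite -addn2 exprD sqr_sqrtr // natrM natrX ler_wpM2r //.
rewrite lerXn2r ?nnegrE ?sqrtr_ge0 //.
by rewrite -[d%:R]ger0_norm // -sqrtr_sqr ler_wsqrtr // -natrX ler_nat.
Qed.

Theorem theorem4 (R : realType) (k : nat) (hk : (1 <= k)%N) :
  exists c : R, forall G : sgraph,
    (0 < #|G|)%N -> no_isolated G ->
    (ramsey k G)%:R <= c * (#|edges G|%:R `^ (k.+1%:R / 2)).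
Proof.
case: k hk => // k _.
exists (k.+2`!%:R * 2 `^ (k.+2%:R / 2)) => G G_gt0 iso.
set n := (2 * #|edges G|)%N.
have ramsey_le : (ramsey k.+1 G <= k.+2`! * degeneracy G ^ k * n)%N.
  by apply: ramsey_le_degeneracy; rewrite ?degeneracy_gt0 ?card_le_edges.
rewrite -mulrA -powRM // -natrM -/n.
apply: le_trans (_ : (k.+2`! * degeneracy G ^ k * n)%N%:R <= _).
  by rewrite ler_nat.
rewrite -mulnA natrM ler_wpM2l //.
exact/natr_expM_le_powR/degeneracy_sqr_le_edges.
Qed.
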